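(* Let $n\ge 1$ and let $X=(X_1,\ldots,X_n)$, where $X_1,\ldots,X_n$ are independent, real-valued, bounded random variables. Let $R_i\subseteq\mathbb{R}$ denote the range (set of values) of $X_i$, and let $F$ be a real-valued function of $x=(x_1,\ldots,x_n)$ that is bounded on $R_1\times\cdots\times R_n$. Let $D_1,\ldots,D_n$ be the McDiarmid diameters of $F$, assumed not all zero, let $n_{\rm eff}=\left(\sum_{i=1}^n D_i\right)^2/\sum_{i=1}^n D_i^2$ be the effective number of independent variates, let $0<\epsilon\le 1$, and let $B_F(\epsilon)$ be the McDiarmid bound for probability $\epsilon$. Let $\Delta F=\sup_x F(x)-\inf_x F(x)$, with supremum and infimum taken over $x\in R_1\times\cdots\times R_n$. Then $$B_F(\epsilon)\ \ge\ \Delta F\,\sqrt{\frac{1}{2\,n_{\rm eff}}\log\frac{1}{\epsilon}}.$$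
   Context: All suprema and infima are taken over values in the ranges of the $X_i$, i.e. each $x_i$ and $x_i'$ varies over $R_i$. The McDiarmid diameters of $F$ are $$D_i=\sup_{x_1,\ldots,x_i,x_i',\ldots,x_n}\left|F(x_1,\ldots,x_i,\ldots,x_n)-F(x_1,\ldots,x_i',\ldots,x_n)\right|,\qquad i=1,\ldots,n,$$ where the two arguments of $F$ differ only in the $i$-th coordinate. The McDiarmid system diameter $D_F\ge 0$ is defined by $D_F^2=D_1^2+D_2^2+\cdots+D_n^2$. The McDiarmid bound for probability $\epsilon$ is $$B_F(\epsilon)=D_F\sqrt{\tfrac12\log\tfrac1\epsilon},$$ i.e. the value of $\delta\ge 0$ at which $\exp\left[-2\delta^2/D_F^2\right]=\epsilon$. Here $\log$ is the natural logarithm. *)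

(* Defs.v *)
From HB Require Import structures.
From mathcomp Require Import all_boot all_order all_algebra.
From mathcomp Require Import all_classical all_reals all_analysis.

Set Implicit Arguments.
Unset Strict Implicit.
Unset Printing Implicit Defensive.

Import Order.TTheory GRing.Theory Num.Theory.
Import numFieldNormedType.Exports.

Local Open Scope classical_set_scope.
Local Open Scope ring_scope.

(* Mutual independence: the product rule over every subfamily. *)
Definition independent_RVs (d d' : measure_display) (T : measurableType d)
    (T' : measurableType d') (R : realType) (P : probability T R)
    (I : finType) (X : I -> {RV P >-> T'}) : Prop :=
  forall (J : {set I}) (A : I -> set T'),
    (forall i, i \in J -> measurable (A i)) ->
    P (\bigcap_(i in [set` J]) (X i @^-1` A i)) =
      (\prod_(i in J) P (X i @^-1` A i))%E.

Definition ranges (d : measure_display) (T : measurableType d) (R : realType)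
    (P : probability T R) (n : nat) (X : 'I_n -> {RV P >-> R}) (i : 'I_n) :
    set R := range (X i).

(* `S i` plays the role of the range of the i-th variable; all suprema and
   infima only see the values of `F` on the product `box S`. *)
Section McDiarmid.
Variables (R : realType) (n : nat).

Definition box (S : 'I_n -> set R) : set 'rV[R]_n :=
  [set x | forall i, S i (x ord0 i)].

Variables (S : 'I_n -> set R) (F : 'rV[R]_n -> R).

Definition differ_only_at (i : 'I_n) (x x' : 'rV[R]_n) : Prop :=
  forall j, j != i -> x ord0 j = x' ord0 j.

Definition mcdiarmid_diam (i : 'I_n) : R :=
  sup [set r | exists x x', [/\ box S x, box S x', differ_only_at i x x'
                               & r = `|F x - F x'|]].

Definition mcdiarmid_system_diam : R :=
  Num.sqrt (\sum_(i < n) mcdiarmid_diam i ^+ 2).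

(* The delta >= 0 with expR (- 2 * delta ^+ 2 / mcdiarmid_system_diam ^+ 2) = eps,
   when the system diameter is nonzero and 0 < eps <= 1. *)
Definition mcdiarmid_bound (eps : R) : R :=
  mcdiarmid_system_diam * Num.sqrt (1 / 2 * ln (1 / eps)).

Definition n_eff : R :=
  (\sum_(i < n) mcdiarmid_diam i) ^+ 2 / \sum_(i < n) mcdiarmid_diam i ^+ 2.

Definition total_diam : R := sup (F @` box S) - inf (F @` box S).

End McDiarmid.

(* Main.v *)
Require Import Defs.
From mathcomp Require Import all_boot all_order all_algebra.
From mathcomp Require Import all_classical all_reals all_analysis.
Import Order.TTheory GRing.Theory Num.Theory.
Import numFieldNormedType.Exports.
Local Open Scope classical_set_scope.
Local Open Scope ring_scope.

(** Changing the coordinates of [x] into those of [y] one at a time and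
    telescoping gives [|F x - F y| <= D_1 + ... + D_n], so the total diameter of
    [F] is at most the sum of the McDiarmid diameters.  As
    [sqrt n_eff = (D_1 + ... + D_n) / D_F], this is the claim up to the common
    factor [sqrt (1 / 2 * ln (1 / eps))]. *)

Section Diameters.
Context {R : realType} {n : nat} {S : 'I_n -> set R} {F : 'rV[R]_n -> R}.
Hypothesis F_bounded : [bounded F x | x in box S].

Lemma box_bound : exists M, forall x, box S x -> `|F x| <= M.
Proof.
have [M [_ HM]] := F_bounded.
by exists (M + 1) => x Sx; apply: HM => //; rewrite ltrDl.
Qed.

Lemma le_mcdiarmid_diam i x x' : box S x -> box S x' ->
  differ_only_at i x x' -> `|F x - F x'| <= mcdiarmid_diam S F i.
Proof.
move=> Sx Sx' xx'; apply: ub_le_sup; last by exists x, x'.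
(* [sup] of an unbounded set is only a default value, so an upper bound is needed: [M + M], by the
   triangle inequality. *)
have [M HM] := box_bound.
exists (M + M) => _ [y [y' [Sy Sy' _ ->]]].
by rewrite (le_trans (ler_normB _ _))// lerD ?HM.
Qed.

Lemma mcdiarmid_diam_ge0 i : box S !=set0 -> 0 <= mcdiarmid_diam S F i.
Proof. by move=> [x Sx]; rewrite (le_trans (normr_ge0 (F x - F x)))// le_mcdiarmid_diam. Qed.

(* [sup set0 = 0], so a nonzero diameter provides a point of the box. *)
Lemma mcdiarmid_diam_neq0_box i : mcdiarmid_diam S F i != 0 -> box S !=set0.
Proof.
apply: contra_neqP => /set0P/negP/negPn/eqP S0.
rewrite /mcdiarmid_diam (_ : [set _ | _] = set0) ?sup0//.
by apply/seteqP; split => // r [x [x' []]]; rewrite S0.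
Qed.

Lemma dist_le_sum_mcdiarmid_diam x y : box S x -> box S y ->
  F y - F x <= \sum_(i < n) mcdiarmid_diam S F i.
Proof.
move=> Sx Sy.
(* [h k] takes its first [k] coordinates from [y] and the others from [x]; it stays in the box
   because the box is a product. *)
pose h k : 'rV[R]_n := \row_j (if (j < k)%N then y ord0 j else x ord0 j).
have Sh k : box S (h k) by move=> j; rewrite mxE; case: ifP.
have -> : y = h n by apply/rowP => j; rewrite mxE ltn_ord.
have -> : x = h 0 by apply/rowP => j; rewrite mxE.
rewrite -(telescope_sumr (F \o h))// big_mkord.
apply: ler_sum => i _; apply: le_trans (ler_norm _) _.
apply: le_mcdiarmid_diam => // j ji.
(* For [j != i], [j < i.+1] and [j < i] agree, so [h i.+1] and [h i] differ only at [i]. *)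
by rewrite !mxE ltnS leq_eqVlt val_eqE (negbTE ji).
Qed.

Lemma total_diam_le_sum : box S !=set0 ->
  total_diam S F <= \sum_(i < n) mcdiarmid_diam S F i.
Proof.
move=> [x0 Sx0]; have S0 : F @` box S !=set0 by exists (F x0), x0.
(* The bound on [F y - F x] is uniform in both points: first the supremum over [y], then the infimum
   over [x]. *)
rewrite lerBlDr; apply: ge_sup => // _ [y Sy <-].
rewrite -lerBlDl; apply: lb_le_inf => // _ [x Sx <-].
by rewrite lerBlDl -lerBlDr dist_le_sum_mcdiarmid_diam.
Qed.

End Diameters.

Theorem theorem2p1 (R : realType) (d : measure_display) (T : measurableType d)
    (P : probability T R) (n : nat) (X : 'I_n -> {RV P >-> R})
    (F : 'rV[R]_n -> R) (eps : R) :
  (1 <= n)%N ->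
  independent_RVs X ->
  (forall i, bounded_fun (X i)) ->
  [bounded F x | x in box (ranges X)] ->
  (exists i, mcdiarmid_diam (ranges X) F i != 0) ->
  0 < eps <= 1 ->
  mcdiarmid_bound (ranges X) F eps >=
    total_diam (ranges X) F * Num.sqrt (1 / (2 * n_eff (ranges X) F) * ln (1 / eps)).
Proof.
move=> _ _ _ F_bounded [i Di0] _.
have S0 := mcdiarmid_diam_neq0_box _ Di0.
have := total_diam_le_sum F_bounded S0.
rewrite /mcdiarmid_bound /n_eff /mcdiarmid_system_diam.
set D := mcdiarmid_diam (ranges X) F in Di0 *.
have D_ge0 j : 0 <= D j := mcdiarmid_diam_ge0 F_bounded j S0.
set s := \sum_j D j; set q := \sum_j D j ^+ 2 => Fs.
have s_gt0 : 0 < s.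
  by rewrite /s (bigD1 i)//= ltr_wpDr ?sumr_ge0// lt_def Di0 D_ge0.
have q_ge0 : 0 <= q by apply: sumr_ge0 => j _; exact: sqr_ge0.
(* Grouping [q] with the logarithm gives both sides the factor
   [Num.sqrt (q * (1 / 2 * ln (1 / eps)))]; what remains is that the total diameter divided by [s]
   is at most 1. *)
have -> : 1 / (2 * (s ^+ 2 / q)) * ln (1 / eps)
    = (s ^+ 2)^-1 * (q * (1 / 2 * ln (1 / eps))).
  by rewrite !div1r 2!invfM invrK -mulrA mulrCA -mulrA.
rewrite sqrtrM ?invr_ge0 ?sqr_ge0// sqrtrV ?sqr_ge0// sqrtr_sqr gtr0_norm//.
rewrite -[leRHS]sqrtrM// mulrA ler_piMl ?sqrtr_ge0//.
by rewrite ler_pdivrMr// mul1r.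
Qed.
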